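(* Let $X$ be an $\alpha$-favorable topological space, let $Y$ be a regular topological space in which every separable closed set is compact, and let $f:X\times Y\to\mathbb R$ be a function which is quasicontinuous with respect to the first variable and continuous with respect to the second variable, and which is (jointly) discontinuous at every point of $X\times Y$. Then there exists a compact set $Y_0\subseteq Y$ which (as a subspace of $Y$) is homeomorphic to the Stone–Čech compactification $\beta\mathbb N$ of the countable discrete space $\mathbb N$.
   Context: All topological spaces are assumed nonempty. Quasicontinuity: a mapping $g:X\to Z$ between topological spaces is quasicontinuous at $x_0\in X$ if for every neighborhood $U$ of $x_0$ in $X$ and every neighborhood $V$ of $g(x_0)$ in $Z$ there exists a nonempty open set $U_1\subseteq U$ in $X$ such that $g(U_1)\subseteq V$; $g$ is quasicontinuous if it is quasicontinuous at every point of $X$. A function $f:X\times Y\to Z$ is quasicontinuous with respect to the first variable if for every $y\in Y$ the mapping $x\mapsto f(x,y)$ is quasicontinuous, and continuous with respect to the second variable if for every $x\in X$ the mapping $y\mapsto f(x,y)$ is continuous. Choquet game on $X$: two players $\alpha$ and $\beta$ alternate. Player $\beta$ first chooses a nonempty open set $U_0\subseteq X$, then $\alpha$ chooses a nonempty open set $V_1\subseteq U_0$, then $\beta$ chooses a nonempty open set $U_1\subseteq V_1$, then $\alpha$ chooses a nonempty open set $V_2\subseteq U_1$, and so on. Player $\alpha$ wins if $\bigcap_{n=1}^\infty V_n\neq\emptyset$; otherwise $\beta$ wins. The space $X$ is called $\alpha$-favorable if $\alpha$ has a winning strategy in this game. *)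

(* Defs.v *)
From HB Require Import structures.
From mathcomp Require Import all_boot all_order all_algebra.
From mathcomp Require Import all_classical all_reals all_analysis.

Set Implicit Arguments.
Unset Strict Implicit.
Unset Printing Implicit Defensive.

Import Order.TTheory GRing.Theory Num.Theory.
Import numFieldNormedType.Exports.

Local Open Scope classical_set_scope.
Local Open Scope ring_scope.

Definition quasicontinuous_at (X Z : topologicalType) (g : X -> Z) (x0 : X) :=
  forall (U : set X) (V : set Z), nbhs x0 U -> nbhs (g x0) V ->
    exists U1 : set X, [/\ open U1, U1 !=set0, U1 `<=` U & g @` U1 `<=` V].

Definition quasicontinuous (X Z : topologicalType) (g : X -> Z) :=
  forall x, quasicontinuous_at g x.

Section choquet_game.
Variable X : topologicalType.

Definition nonempty_open (A : set X) := open A /\ A !=set0.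

(* A strategy for alpha maps beta's moves so far, [:: U 0; ...; U n], to
   alpha's reply.  alpha's own earlier moves are determined by these data. *)
Definition alpha_strategy := seq (set X) -> set X.

(* The indices are shifted by one: [reply s U n] is V_(n+1), the answer to U_n *)
Definition reply (s : alpha_strategy) (U : nat -> set X) (n : nat) : set X :=
  s (mkseq U n.+1).

Definition beta_legal (s : alpha_strategy) (U : nat -> set X) (n : nat) :=
  (forall i, (i <= n)%N -> nonempty_open (U i)) /\
  (forall i, (i < n)%N -> U i.+1 `<=` reply s U i).

(* Legality of alpha's replies is required after every finite legal play: a
   condition on infinite plays only would be vacuous for a strategy that leaves
   beta without a legal move. *)
Definition alpha_winning (s : alpha_strategy) :=
  forall U : nat -> set X,
    (forall n, beta_legal s U n ->
      nonempty_open (reply s U n) /\ reply s U n `<=` U n) /\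
    ((forall n, beta_legal s U n) -> \bigcap_n reply s U n !=set0).

Definition alpha_favorable := exists s : alpha_strategy, alpha_winning s.

End choquet_game.

Definition separable_set (Y : topologicalType) (A : set Y) :=
  exists D : set Y, [/\ countable D, D `<=` A & A `<=` closure D].

Definition homeomorphic (S T : topologicalType) :=
  exists (f : S -> T) (g : T -> S),
    [/\ cancel f g, cancel g f, continuous f & continuous g].

(* The Stone-Cech compactification of X: the closure of the image of X in the
   Tychonoff cube I ^ C(X, I), I = [0, 1], under x |-> (f x)_f. *)
Section stone_cech.
Variables (R : realType) (X : topologicalType).

Definition unit_interval : topologicalType := set_type (`[0, 1]%classic : set R).

Definition tychonoff_cube : topologicalType :=
  {ptws continuousType X unit_interval -> unit_interval}.

Definition stone_cech_map (x : X) : tychonoff_cube := fun f => f x.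

Definition stone_cech : topologicalType := set_type (closure (range stone_cech_map)).

End stone_cech.

(* Main.v *)
Require Import Defs.
From mathcomp Require Import all_boot all_order all_algebra.
From mathcomp Require Import all_classical all_reals all_analysis.
From mathcomp Require Import lra.
Import Order.TTheory GRing.Theory Num.Theory.
Import numFieldNormedType.Exports.
Local Open Scope classical_set_scope.

(** The copy of the Stone-Cech compactification is found in the closure of a
    sequence [u] in [Y] such that, for every set [T] of integers, the closures
    of [u @` T] and [u @` ~` T] are disjoint.  Among the compactifications of a
    discrete space this property characterises the Stone-Cech one: two dense
    maps from one index set that both have it can be matched limit by limit
    ([homeomorphic_dense_compactification]).  Since [Y] is only assumed regular,
    distinct points may be topologically indistinguishable, and the copy
    consists of one chosen limit of [u] along each ultrafilter, not of the whole
    closure.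

    The closures are separated by vertical sections of [f]: there are reals
    [a < b] and, for every [T], a point [x] with [b < f (x, u n)] for [n] in [T]
    and [f (x, u n) < a] for the other [n] ([splitting_sequence]).  Such an [x]
    is the outcome of a Choquet game in which, at stage [n], beta passes to the
    part of alpha's last move where [f (-, u n)] is above [b] or below [a],
    according to whether [n] is in [T].  The games for all [T] run together and
    form a binary tree, so [u n] must be chosen to allow both continuations at
    all [2 ^ n] nodes of level [n] at once.

    That choice is where discontinuity at every point is used.  For a nonempty
    open [U], say that [y] crosses if [f (-, y)] takes on [U] both a value below
    [a] and a value above [b]; as [f] is continuous in [y], the crossing points
    form an open set.  Suppose that they meet every nonempty open subset of
    [V0], for every nonempty open [U] inside [U0].  Then finitely many [U]s are
    served by finitely many dense open sets of [V0], which have a common point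
    ([simultaneous_crossing]).

    It remains to find such [a], [b], [U0] and [V0].  At each point,
    discontinuity of [f] and continuity in [y] produce rational [a < b] that are
    crossed in every neighbourhood of the point ([discontinuous_crosses]).  For
    each pair [(a, b)] the points so obtained form a closed set.  Countably many
    closed sets cover [X * Y], and one of them has interior points, by a Baire
    category argument that plays the Choquet game on [X] and a nested sequence of
    closed neighbourhoods on [Y] ([favorable_product_category]). *)

Set Implicit Arguments.
Unset Strict Implicit.

(** * Generalities on subspaces, closures and quasicontinuity *)

Lemma set_type_hausdorff (T : topologicalType) (A : set T) :
  hausdorff_space T -> hausdorff_space (set_type A).
Proof.
move=> hT x y clxy; apply: val_inj; apply: hT => V W xV yW.
have [z [Vz Wz]] := clxy _ _
  (@initial_continuous _ _ (set_val : A -> T) x V xV)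
  (@initial_continuous _ _ (set_val : A -> T) y W yW).
by exists (val z).
Qed.

Lemma set_type_compact (T : topologicalType) (A : set T) :
  compact A -> compact [set: set_type A].
Proof.
move=> cA F FF _.
have [|x [Ax clx]] := cA (set_val @ F) (fmap_proper_filter _ _).
  by apply: (@filterS _ F _ setT) filterT => -[x xA] _ /=; exact: set_mem.
exists (exist _ x (mem_set Ax)); split=> // V W FV [_ [[P oP <-] /= Px PW]].
have [||_ [[z Vz <-] Pz]] := clx (set_val @` V) P.
- by apply: (@filterS _ F _ V) FV => z Vz; exists z.
- exact: open_nbhs_nbhs.
by exists z; split=> //; exact: PW.
Qed.

Lemma closure_image_subset (J : Type) (S : topologicalType) (e : J -> S)
    (T : set J) (A : set S) :
  closed A -> (forall i, T i -> A (e i)) -> closure (e @` T) `<=` A.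
Proof.
move=> cA TA; apply: subset_trans (closureS _) cA.
by move=> _ [i Ti <-]; exact: TA.
Qed.

Lemma closure_range_compact (Y : topologicalType) (u : nat -> Y) :
  (forall A : set Y, closed A -> separable_set A -> compact A) ->
  compact (closure (range u)).
Proof.
move=> cptY; apply: cptY; first exact: closed_closure.
exists (range u); split=> //; last exact: subset_closure.
by apply: card_le_trans (card_image_le _ _) _.
Qed.

Lemma quasicontinuous_interior (X Z : topologicalType) (g : X -> Z) (U : set X)
    (B : set Z) x :
  quasicontinuous g -> open U -> open B -> U x -> B (g x) ->
  (U `&` g @^-1` B)° !=set0.
Proof.
move=> qg oU oB Ux Bgx.
have [U1 [oU1 [z U1z] U1U gU1]] := qg x U B
  (open_nbhs_nbhs (conj oU Ux)) (open_nbhs_nbhs (conj oB Bgx)).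
exists z; apply: filterS (open_nbhs_nbhs (conj oU1 U1z)) => t U1t.
by split; [exact: U1U|apply: gU1; exists t].
Qed.

(** * Compactifications of a discrete index set *)

(** For the inclusion of a discrete space into a compactification, this says
    that each point is the limit of a single ultrafilter of index sets, so that
    the compactification is the Stone-Cech one. *)
Definition separates_parts {I : Type} {S : topologicalType} (e : I -> S) :=
  forall (T : set I) z, closure (e @` T) z -> closure (e @` ~` T) z -> False.

Lemma dense_closure_part {I : Type} {S : topologicalType} (e : I -> S) T z :
  closure (range e) z -> ~ closure (e @` ~` T) z -> closure (e @` T) z.
Proof.
move=> clz /existsNP[W /not_implyP[zW W0]] B zB.
have [_ [[i _ <-] [Wi Bi]]] := clz _ (filterI zW zB).
exists (e i); split=> //; exists i => //; apply: contrapT => nTi.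
by apply: W0; exists (e i); split=> //; exists i.
Qed.

(** Regularity lets a neighbourhood of [z] be tested on index sets alone: it
    contains all points close to a part [T] that is large around [z]. *)
Lemma regular_part {I : Type} {S : topologicalType} (e : I -> S) z W :
  regular_space S -> nbhs z W ->
  exists T : set I,
    ~ closure (e @` ~` T) z /\ closure (e @` T) `<=` W.
Proof.
move=> regS zW; have [W' zW' W'W] := regS _ _ zW.
exists (e @^-1` W'); split; first by move=> /(_ _ zW') [_ [[i + <-] +]].
by apply: subset_trans W'W; apply: closureS => _ [i + <-].
Qed.

(** The traces on [I] of the neighbourhoods of [z] form a filter, and [g z] is
    any cluster point of its image.  If [z] is close to [e @` T], then by the
    separation it has a neighbourhood that misses [e @` ~` T], so [T] belongs to
    the filter and the cluster point is close to [u @` T]. *)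
Lemma extend_to_dense_compactification {I : Type} {S Y : topologicalType}
    (e : I -> S) (u : I -> Y) :
  (forall z, closure (range e) z) -> separates_parts e ->
  compact (closure (range u)) ->
  exists g : S -> Y, forall z T, closure (e @` T) z -> closure (u @` T) (g z).
Proof.
move=> dense_e sep_e cpt.
suff /choice[g gP] : forall z, exists y, forall T,
    closure (e @` T) z -> closure (u @` T) y by exists g.
move=> z; pose F := filter_from (nbhs z) (preimage e).
have FF : ProperFilter F.
  apply: filter_from_proper.
    apply: filter_from_filter; first by exists setT; exact: filterT.
    by move=> A B zA zB; exists (A `&` B) => //; exact: filterI.
  by move=> A zA; have [_ [[i _ <-] Ai]] := dense_e z A zA; exists i.
have [|y [_ uFy]] := cpt (u @ F) (fmap_proper_filter _ _).
  exists setT; first exact: filterT.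
  by move=> i _; apply: subset_closure; exists i.
exists y => T eTz; have /existsNP[W /not_implyP[zW W0]] := sep_e T z eTz.
move: uFy; rewrite clusterE; apply; exists W => // i Wi /=; exists i => //.
by apply: contrapT => nTi; apply: W0; exists (e i); split => //; exists i.
Qed.

(** The extension [g] transports closeness to parts in both directions, because
    every point is close to exactly one of [T] and [~` T].  Regularity of both
    spaces expresses neighbourhoods through such closeness, so that [g] is
    continuous and open onto its image by the same argument. *)
Lemma homeomorphic_dense_compactification {I : Type} {S Y : topologicalType}
    (e : I -> S) (u : I -> Y) :
  compact [set: S] -> hausdorff_space S ->
  (forall z, closure (range e) z) -> separates_parts e ->
  regular_space Y -> compact (closure (range u)) -> separates_parts u ->
  exists Y0 : set Y, compact Y0 /\ homeomorphic (set_type Y0) S.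
Proof.
move=> cptS hausS dense_e sep_e regY cptu sep_u.
have regS : regular_space S.
  by move=> z; apply: (compact_regular hausS cptS); exact: filterT.
have [g gP] := extend_to_dense_compactification dense_e sep_e cptu.
have gP' z T : closure (u @` T) (g z) -> closure (e @` T) z.
  move=> uTgz; apply: dense_closure_part => // /gP; exact: sep_u uTgz.
have g_cont : continuous g.
  move=> z W /(regular_part u regY)[T [nT TW]].
  have op : open (~` closure (e @` ~` T)) by exact/closed_openC/closed_closure.
  have : nbhs z (~` closure (e @` ~` T)).
    by apply: open_nbhs_nbhs; split=> // /gP.
  by apply: filterS => z' /(dense_closure_part (dense_e z'))/gP/TW.
have g_nbhs z W : nbhs z W ->
    exists2 V, nbhs (g z) V & forall z', V (g z') -> W z'.
  move=> /(regular_part e regS)[T [nT TW]].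
  exists (~` closure (u @` ~` T)).
    apply: open_nbhs_nbhs; split; first exact/closed_openC/closed_closure.
    by move=> /gP'.
  by move=> z' nz'; apply/TW/dense_closure_part => // /gP.
have g_inj : injective g.
  move=> z z' gzz'; apply: hausS => A B zA z'B.
  have [V gV VA] := g_nbhs _ _ zA; exists z'; split.
    by apply: VA; rewrite -gzz'; exact: nbhs_singleton.
  exact: nbhs_singleton.
exists (range g); split.
  by apply: continuous_compact => //; exact: continuous_subspaceT.
have h_ex (y : set_type (range g)) : exists z, g z = val y.
  by case: y => y /= /set_mem [z _ <-]; exists z.
have [h hP] := choice h_ex.
pose k z : set_type (range g) := exist _ (g z) (mem_set (imageT g z)).
exists h, k; split.
- by move=> y; apply: val_inj; rewrite /= hP.
- by move=> z; apply: g_inj; rewrite hP.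
- move=> y W /g_nbhs[V + VW]; rewrite hP => yV.
  have svV : nbhs y (set_val @^-1` V).
    exact: (@initial_continuous _ _ (set_val : range g -> Y) y V yV).
  apply: (@filterS _ (nbhs y) _ (set_val @^-1` V)) => //.
  by move=> y'; rewrite /= set_valE -hP; exact: VW.
- move=> z W [_ [[P oP <-] /= Pz PW]].
  have : nbhs z (g @^-1` P) by apply: g_cont; exact: open_nbhs_nbhs.
  by apply: filterS => z' Pz'; apply: PW.
Qed.

Section stone_cech_discrete.
Variables (R : realType) (X : discreteTopologicalType).
Local Notation I := (unit_interval R).
Local Notation cube := (tychonoff_cube R X).
Local Notation beta := (stone_cech R X).
Local Open Scope ring_scope.

Lemma cube_compact : compact [set: cube].
Proof.
have cI : compact [set: I] by apply: set_type_compact; exact: segment_compact.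
have := @tychonoff (continuousType X I) (fun=> I) _ (fun=> cI).
by congr (compact _); apply/seteqP; split.
Qed.

Lemma beta_compact : compact [set: beta].
Proof.
apply: set_type_compact; apply: subclosed_compact cube_compact _ => //.
exact: closed_closure.
Qed.

Lemma beta_hausdorff : hausdorff_space beta.
Proof.
apply: set_type_hausdorff; apply: hausdorff_product => _.
by apply: set_type_hausdorff; exact: Rhausdorff.
Qed.

Definition beta_unit (x : X) : beta :=
  exist (fun p => p \in closure (range (@stone_cech_map R X))) _
    (mem_set (subset_closure (imageT (@stone_cech_map R X) x))).

Lemma beta_unit_dense (z : beta) : closure (range beta_unit) z.
Proof.
move=> B [_ [[P oP <-] /= Pz PB]].
have zcl : closure (range (@stone_cech_map R X)) (val z) by exact: set_valP.
have [_ [[n _ <-] Pn]] := zcl P (open_nbhs_nbhs (conj oP Pz)).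
by exists (beta_unit n); split => //; exact: PB.
Qed.

Lemma indic_itv (T : set X) n : \1_T n \in (`[0, 1]%classic : set R).
Proof.
by rewrite inE /= in_itv /= indicE; case: (_ \in _); rewrite ?lexx ler01.
Qed.

(** On a discrete space the indicator of [T] is one of the coordinates of the
    cube; it is 1 on the closure of [T] and 0 on the closure of [~` T]. *)
Lemma beta_unit_separates : separates_parts beta_unit.
Proof.
move=> T z Tz nTz.
pose h n : I :=
  exist (fun x => x \in (`[0, 1]%classic : set R)) _ (indic_itv T n).
have h_cont : continuous h.
  by move=> n A /nbhs_singleton hA; apply: filterS (discrete_set1 n) => _ ->.
pose pr (w : beta) : R := set_val (set_val w (mkcts h_cont)).
have pr_cont : continuous pr.
  have proj_cont : continuous (fun w : beta => set_val w (mkcts h_cont)).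
    move=> w; apply: (@continuous_comp beta cube I set_val
      (fun p : cube => p (mkcts h_cont))); first exact: initial_continuous.
    exact: (@proj_continuous _ (fun=> I)).
  move=> w; apply: (@continuous_comp beta I R _ set_val).
    exact: proj_cont.
  exact: initial_continuous.
have pr1 : pr z = 1.
  apply: (@closure_image_subset _ _ beta_unit T (pr @^-1` [set 1])) Tz => //.
    by apply: closed_comp => // *; exact: pr_cont.
  by move=> n Tn; rewrite /= /pr !set_valE /= indicE mem_set.
have pr0 : pr z = 0.
  apply: (@closure_image_subset _ _ beta_unit (~` T) (pr @^-1` [set 0])) nTz.
    by apply: closed_comp => // *; exact: pr_cont.
  by move=> n Tn; rewrite /= /pr !set_valE /= indicE memNset.
by move/eqP: pr0; rewrite pr1 oner_eq0.
Qed.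

End stone_cech_discrete.

(** * The Choquet game and category in the product *)

(** Runs are presented by the histories [h n] of beta's moves up to stage [n],
    the form in which a strategy reads them; [w n] is the move that beta makes
    after the answer to [h n].  [winning_reply] asks legality only of the moves
    already made, so that a run can be built and checked by induction. *)
Section run_against_winning_strategy.
Context (X : topologicalType) (s : alpha_strategy X).
Context (s_wins : alpha_winning s).
Context (U0 : set X) (h : nat -> seq (set X)) (w : nat -> set X).
Context (U0_open : nonempty_open U0) (h0 : h 0 = [:: U0])
  (hS : forall n, h n.+1 = rcons (h n) (w n)).

Definition legal_move n := nonempty_open (w n) /\ w n `<=` s (h n).

Let W n := if n is m.+1 then w m else U0.

Let mkseq_W n : mkseq W n.+1 = h n.
Proof. by elim: n => [|n IH]; rewrite ?h0 // mkseqS IH hS. Qed.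

Let W_legal n : (forall m, (m < n)%N -> legal_move m) -> beta_legal s W n.
Proof.
move=> legal; split=> [[|i] lein //=|i ltin]; first by case: (legal i lein).
by rewrite /reply mkseq_W; case: (legal i ltin).
Qed.

Let W_reply n : (forall m, (m < n)%N -> legal_move m) ->
  nonempty_open (s (h n)) /\ s (h n) `<=` W n.
Proof.
by move=> /W_legal; have [+ _] := s_wins W => /[apply]; rewrite /reply mkseq_W.
Qed.

Lemma winning_reply n : (forall m, (m < n)%N -> legal_move m) ->
  nonempty_open (s (h n)) /\ s (h n) `<=` U0.
Proof.
move=> legal; split; first by have [] := W_reply legal.
elim: n legal => [|n IH] legal; first by have [] := W_reply legal.
have [_ sW] := W_reply legal; have [_ ws] := legal n (ltnSn n).
apply: subset_trans sW (subset_trans ws (IH _)) => m /ltnW; exact: legal.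
Qed.

Lemma winning_point : (forall n, legal_move n) -> exists x, forall n, w n x.
Proof.
move=> legal; have [_ [|x xW]] := s_wins W.
  by move=> n; apply: W_legal => m _; exact: legal.
exists x => n; have := xW n.+1 I; rewrite /reply mkseq_W.
by have [|_] := @W_reply n.+1; [move=> m _; exact: legal|exact].
Qed.

End run_against_winning_strategy.

(** Points chosen in the [V n] have a compact closure, and a cluster point of
    their sequence lies in the closure of every [V n]. *)
Lemma nested_open_point (Y : topologicalType) (V : nat -> set Y) :
  (forall A : set Y, closed A -> separable_set A -> compact A) ->
  (forall n, V n !=set0) -> (forall n, closure (V n.+1) `<=` V n) ->
  exists y, forall n, V n y.
Proof.
move=> cptY /choice[u uV] clV.
have VS n : V n.+1 `<=` V n.
  by apply: subset_trans (clV n); exact: subset_closure.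
have Vm n k : V (n + k)%N `<=` V n.
  elim: k => [|k IH]; first by rewrite addn0.
  by rewrite addnS; apply: subset_trans (VS _) IH.
have cptu : compact (closure (range u)) by exact: closure_range_compact.
have [|y [_ cly]] := cptu (u @ \oo) (fmap_proper_filter _ _).
  by exists 0%N => // n _; apply: subset_closure; exists n.
exists y => n; apply: clV => B yB; apply: cly => //.
exists n.+1 => // k /= lenk; rewrite -(subnKC lenk); exact: Vm (uV _).
Qed.

(** Were no [G i] to contain a box, beta could avoid [G i] at the stage [n] that
    encodes [i], by shrinking a box [A `*` V] to a smaller one: its first side
    is beta's move, its second side has its closure inside [V].  The point of
    [X] won by alpha and a point common to the second sides then form a pair
    outside every [G i]. *)
Lemma favorable_product_category (I : countType) (X Y : topologicalType)
    (G : I -> set (X * Y)) :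
  [set: X] !=set0 -> [set: Y] !=set0 -> alpha_favorable X ->
  regular_space Y ->
  (forall A : set Y, closed A -> separable_set A -> compact A) ->
  (forall i, closed (G i)) -> (forall p, exists i, G i p) ->
  exists i U V, [/\ nonempty_open U, nonempty_open V & U `*` V `<=` G i].
Proof.
move=> X0 Y0 [s s_wins] regY cptY clG covG; apply: contrapT => noG.
(* A triple [(n, A, V)] holds the stage, alpha's last answer and the current
   second side. *)
have next_ex (t : nat * set X * set Y) : exists t' : set X * set Y,
    nonempty_open t.1.2 -> nonempty_open t.2 ->
    [/\ nonempty_open t'.1, t'.1 `<=` t.1.2, nonempty_open t'.2,
        closure t'.2 `<=` t.2
      & forall i, unpickle t.1.1 = Some i ->
          forall p, (t'.1 `*` t'.2) p -> ~ G i p].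
  case: t => [[n A] V] /=.
  have [[oA nA]|?] := pselect (nonempty_open A); last by exists (A, V).
  have [[oV nV]|?] := pselect (nonempty_open V); last by exists (A, V).
  have [[x y] /= [Ax Vy] [/= P [Px Py] PG]] : exists2 p, (A `*` V) p &
      nbhs p (fun q => forall i, unpickle n = Some i -> ~ G i q).
    case: (unpickle n) => [i|]; last first.
      have [[x Ax] [y Vy]] := (nA, nV); exists (x, y) => //.
      by apply: filterS filterT => q _ j.
    have /existsNP[p /not_implyP[pAV nGp]] : ~ (A `*` V `<=` G i).
      by move=> AVG; apply: noG; exists i, A, V.
    exists p => //.
    have : nbhs p (~` G i).
      by apply: open_nbhs_nbhs; split=> //; exact/closed_openC.
    by apply: filterS => q nGq j [<-].
  have [V' yV' V'V] := regY y _ (filterI Py (open_nbhs_nbhs (conj oV Vy))).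
  exists (A `&` P.1°, V'°); split=> /=.
  - split; first by apply: openI => //; exact: open_interior.
    by exists x.
  - by move=> ? [].
  - by split; [exact: open_interior|exists y].
  - apply: subset_trans (_ : closure V' `<=` V).
      by apply: closureS; exact: interior_subset.
    by move=> z /V'V[].
  move=> i ni [x' y'] [/= [_ Px'] V'y'].
  apply: (PG (x', y')) ni; split=> /=; first exact: interior_subset Px'.
  by have /subset_closure/V'V[] := interior_subset V'y'.
have [next nextP] := choice next_ex.
pose move (n : nat) (t : seq (set X) * set Y) := next (n, s t.1, t.2).
pose st n := iteri n (fun k t => (rcons t.1 (move k t).1, (move k t).2))
  ([:: [set: X]], [set: Y]).
pose h n := (st n).1; pose V n := (st n).2; pose w n := (move n (st n)).1.
have X_open : nonempty_open [set: X] by split=> //; exact: openT.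
have hS n : h n.+1 = rcons (h n) (w n) by [].
have moveP n : (forall m, (m < n)%N -> legal_move s h w m) ->
    nonempty_open (V n) -> [/\ nonempty_open (w n), w n `<=` s (h n),
      nonempty_open (V n.+1), closure (V n.+1) `<=` V n
      & forall i, unpickle n = Some i ->
          forall p, (w n `*` V n.+1) p -> ~ G i p].
  move=> legal Vn; apply: (nextP (n, s (h n), V n)) => //=.
  by have [] := winning_reply s_wins X_open erefl hS legal.
have inv n : (forall m, (m < n)%N -> legal_move s h w m) /\ nonempty_open (V n).
  elim: n => [|n [legal Vn]].
    by split=> //; split=> //; exact: openT.
  have [wn wns VSn _ _] := moveP n legal Vn; split=> // m.
  by rewrite ltnS leq_eqVlt => /orP[/eqP ->//|]; exact: legal.
have {}moveP n := moveP n (inv n).1 (inv n).2.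
have [x xw] := winning_point s_wins X_open erefl hS
  (fun n => (inv n.+1).1 n (ltnSn n)).
have [||y yV] := nested_open_point (V := V) cptY.
- by move=> n; have [_ []] := inv n.
- by move=> n; have [] := moveP n.
have [i Gi] := covG (x, y).
by have [_ _ _ _ /(_ i (pickleK i) (x, y))] := moveP (pickle i); apply.
Qed.

(** * Crossing two levels *)

Section crossing.
Context {R : realType} {X Y : topologicalType} (f : X * Y -> R).
Context (f_continuous : forall x : X, continuous (fun y : Y => f (x, y))).
Local Open Scope ring_scope.

Definition crosses (a b : R) (U : set X) (y : Y) :=
  (exists2 x, U x & f (x, y) < a) /\ (exists2 x, U x & b < f (x, y)).

Lemma crosses_open a b U : open (crosses a b U).
Proof.
have -> : crosses a b U =
    (\bigcup_(x in U) (fun y => f (x, y)) @^-1` [set r | r < a]) `&`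
    (\bigcup_(x in U) (fun y => f (x, y)) @^-1` [set r | b < r]) by [].
by apply: openI; apply: bigcup_open => x _; apply: open_comp => [y _|];
  [exact: f_continuous|exact: open_lt|exact: f_continuous|exact: open_gt].
Qed.

(** Near [y0] the values [f (x0, y)] stay close to [c], while values at distance
    at least [e] from [c] occur arbitrarily close to [(x0, y0)].  If those above
    [c + e] do so, two levels between [c] and [c + e] are crossed; otherwise
    those below [c - e] do, and two levels between [c - e] and [c] are. *)
Lemma discontinuous_crosses x0 y0 : ~ {for (x0, y0), continuous f} ->
  exists a b : rat, ratr a < ratr b :> R /\
    forall U V, nbhs x0 U -> nbhs y0 V ->
      exists2 y, V y & crosses (ratr a) (ratr b) U y.
Proof.
set c := f (x0, y0).
move=> /cvgrPdist_lt/existsNP[e /not_implyP[e0 far]].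
have [b1 /itvP b1P] := rat_in_itvoo (ltr_pwDr e0 (lexx c)).
have [a1 /itvP a1P] : exists q, ratr q \in `]c, (ratr b1)[ by
  apply: rat_in_itvoo; rewrite b1P.
have [a2 /itvP a2P] : exists q, ratr q \in `](c - e), c[ by
  apply: rat_in_itvoo; rewrite ltrBlDr ltr_pwDr.
have [b2 /itvP b2P] : exists q, ratr q \in `](ratr a2), c[ by
  apply: rat_in_itvoo; rewrite a2P.
apply: contrapT => /forallNP noab.
have bad (a b : rat) : ratr a < ratr b :> R -> exists U V,
    [/\ nbhs x0 U, nbhs y0 V
      & forall y, V y -> ~ crosses (ratr a) (ratr b) U y].
  move=> ab; have /forallNP/(_ b)/not_andP[//|] := noab a.
  move=> /existsNP[U /existsNP[V /not_implyP[xU /not_implyP[yV nex]]]].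
  by exists U, V; split=> // y Vy cr; apply: nex; exists y.
have [|U1 [V1 [xU1 yV1 bad1]]] := bad a1 b1; first by rewrite a1P.
have [|U2 [V2 [xU2 yV2 bad2]]] := bad a2 b2; first by rewrite b2P.
apply: far.
have yV : nbhs y0 (fun y => ratr b2 < f (x0, y) < ratr a1).
  have gtb2 : nbhs c [set r | ratr b2 < r].
    by apply: open_nbhs_nbhs; split; [exact: open_gt|rewrite /= b2P].
  have lta1 : nbhs c [set r | r < ratr a1].
    by apply: open_nbhs_nbhs; split; [exact: open_lt|rewrite /= a1P].
  have gt_near : nbhs y0 (fun y => ratr b2 < f (x0, y)) := f_continuous gtb2.
  have lt_near : nbhs y0 (fun y => f (x0, y) < ratr a1) := f_continuous lta1.
  by apply: filterS (filterI gt_near lt_near) => y [b2y ya1]; apply/andP.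
exists (U1 `&` U2, V1 `&` V2 `&` [set y | ratr b2 < f (x0, y) < ratr a1]).
  by split=> /=; do ?apply: filterI.
move=> [x y] /= [[U1x U2x] [[V1y V2y] /andP[by0 ya0]]].
rewrite -[f (x0, y0)]/c ltr_norml.
apply/andP; split; rewrite ltNge; apply/negP => le.
- apply: (bad1 y V1y); split; first by exists x0 => //; exact: nbhs_singleton.
  by exists x => //; have ltb1 : ratr b1 < c + e; [by rewrite b1P|lra].
- apply: (bad2 y V2y); split; last by exists x0 => //; exact: nbhs_singleton.
  by exists x => //; have gta2 : c - e < ratr a2; [by rewrite a2P|lra].
Qed.

(** In [V0] the points crossing a given [U] inside [U0] form a dense open set,
    and finitely many such sets intersect. *)
Lemma simultaneous_crossing a b (U0 : set X) (V0 : set Y) :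
  nonempty_open V0 ->
  (forall U V, nonempty_open U -> U `<=` U0 -> nonempty_open V -> V `<=` V0 ->
    exists2 y, V y & crosses a b U y) ->
  forall r : seq (set X), exists y, forall U, U \in r -> nonempty_open U ->
    U `<=` U0 -> crosses a b U y.
Proof.
move=> V0_open cr r.
suff gen V : nonempty_open V -> V `<=` V0 -> exists2 y, V y & forall U,
    U \in r -> nonempty_open U -> U `<=` U0 -> crosses a b U y.
  by have [|y _ yP] := gen V0 V0_open; [exact: subset_refl|exists y].
elim: r V => [|A r IH] V [oV nV] VV0; first by have [y Vy] := nV; exists y.
have [[A_open AU0]|nA] := pselect (nonempty_open A /\ A `<=` U0); last first.
  have [y Vy yP] := IH V (conj oV nV) VV0; exists y => // U.
  by rewrite inE => /orP[/eqP-> Uo UU0|]; [case: nA|exact: yP].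
have [y1 Vy1 cr1] := cr A V A_open AU0 (conj oV nV) VV0.
have [||y [Vy cry] yP] := IH (V `&` crosses a b A).
- split; last by exists y1.
  by apply: openI => //; exact: crosses_open.
- by move=> y [/VV0].
by exists y => // U; rewrite inE => /orP[/eqP->|]; [|exact: yP].
Qed.

End crossing.

(** The points around which a given rational pair is crossed form a closed set,
    and these countably many sets cover the product. *)
Lemma crossing_box {R : realType} {X Y : topologicalType} (f : X * Y -> R) :
  [set: X] !=set0 -> [set: Y] !=set0 -> alpha_favorable X ->
  regular_space Y ->
  (forall A : set Y, closed A -> separable_set A -> compact A) ->
  (forall x : X, continuous (fun y : Y => f (x, y))) ->
  (forall p : X * Y, ~ {for p, continuous f}) ->
  exists (a b : R) U0 V0,
    [/\ (a < b)%R, nonempty_open U0, nonempty_open V0 &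
      forall U V, nonempty_open U -> U `<=` U0 -> nonempty_open V ->
        V `<=` V0 -> exists2 y, V y & crosses f a b U y].
Proof.
move=> X_nonempty Y_nonempty X_favorable Y_regular Y_separable_compact.
move=> f_continuous f_discontinuous.
pose G (i : rat * rat) : set (X * Y) :=
  [set p | (ratr i.1 < ratr i.2 :> R)%R /\
  forall U V, nbhs p.1 U -> nbhs p.2 V ->
    exists2 y, V y & crosses f (ratr i.1) (ratr i.2) U y].
have [||[a b] [U0 [V0 [U0_open V0_open sub]]]] :=
  favorable_product_category (G := G) X_nonempty Y_nonempty X_favorable
    Y_regular Y_separable_compact.
- move=> i p clp; split.
    by have [q [[]]] := clp setT filterT.
  move=> U V pU pV.
  have [|q [[_ Gq] [qU qV]]] := clp (U° `*` V°).
    by exists (U°, V°) => //; split; exact: nbhs_interior.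
  exact: Gq.
- move=> [x y].
  have [a [b [ltab ab]]] := discontinuous_crosses f_continuous
    (@f_discontinuous (x, y)).
  by exists (a, b).
exists (ratr a), (ratr b), U0, V0; split=> //.
  have [[_ [x U0x]] [_ [y V0y]]] := (U0_open, V0_open).
  by have [] := sub (x, y) (conj U0x V0y).
move=> U V [oU [x Ux]] UU0 [oV [y Vy]] VV0.
have [_ Gxy] := sub (x, y) (conj (UU0 _ Ux) (VV0 _ Vy)).
by apply: Gxy; exact: open_nbhs_nbhs.
Qed.

(** Alpha's winning strategy is played along every branch of a binary tree of
    moves.  [level n] lists the histories of all branches of length [n] and
    [u n] crosses alpha's answers to all of them; by quasicontinuity both halves
    of an answer cut out by [f (-, u n)] have interior points, and beta moves to
    the interior chosen by [T]. *)
Lemma splitting_sequence {R : realType} {X Y : topologicalType} (f : X * Y -> R)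
    (a b : R) (U0 : set X) :
  alpha_favorable X ->
  (forall y : Y, quasicontinuous (fun x : X => f (x, y))) ->
  nonempty_open U0 ->
  (forall r : seq (set X), exists y, forall U, U \in r -> nonempty_open U ->
    U `<=` U0 -> crosses f a b U y) ->
  exists u : nat -> Y, forall T : set nat, exists x, forall n,
    if n \in T then (b < f (x, u n))%R else (f (x, u n) < a)%R.
Proof.
move=> [s s_wins] f_quasicontinuous U0_open /choice[pick pickP].
pose side t : set R := if t then [set r | b < r]%R else [set r | r < a]%R.
pose half (U : set X) y t := (U `&` (fun x => f (x, y)) @^-1` side t)°.
have half_open U y t : open U -> crosses f a b U y ->
    nonempty_open (half U y t) /\ half U y t `<=` U.
  move=> oU [[x1 Ux1 lta] [x2 Ux2 ltb]]; split; last first.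
    by move=> x /interior_subset[].
  split; first exact: open_interior.
  case: t.
    exact: (@quasicontinuous_interior _ R (fun x => f (x, y)) U (side true) x2).
  exact: (@quasicontinuous_interior _ R (fun x => f (x, y)) U (side false) x1).
pose grow (L : seq (seq (set X))) :=
  [seq rcons h (half (s h) (pick (map s L)) t) | h <- L, t <- [:: true; false]].
pose level n := iter n grow [:: [:: U0]].
pose u n := pick (map s (level n)).
exists u => T.
pose h n := iteri n (fun k h => rcons h (half (s h) (u k) (k \in T))) [:: U0].
pose w n := half (s (h n)) (u n) (n \in T).
have hS n : h n.+1 = rcons (h n) (w n) by [].
have h_level n : h n \in level n.
  elim: n => [|n IH]; first by rewrite inE.
  apply/allpairsP; exists (h n, n \in T); split=> //.
  by case: (n \in T); rewrite !inE.
have legal n : legal_move s h w n.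
  elim/ltn_ind: n => n IH.
  have [sh_open shU0] := winning_reply s_wins U0_open erefl hS IH.
  apply: half_open; first by case: sh_open.
  by apply: pickP => //; exact: map_f.
have [x xw] := winning_point s_wins U0_open erefl hS legal.
exists x => n; have /interior_subset[_] := xw n.
by rewrite /preimage /side /=; case: (n \in T).
Qed.

(** * The copy of the Stone-Cech compactification *)

Theorem corollary2p3 (R : realType) (X Y : topologicalType)
    (X_nonempty : [set: X] !=set0) (Y_nonempty : [set: Y] !=set0)
    (X_favorable : alpha_favorable X)
    (Y_regular : regular_space Y)
    (Y_separable_compact :
      forall A : set Y, closed A -> separable_set A -> compact A)
    (f : X * Y -> R)
    (f_quasicontinuous : forall y : Y, quasicontinuous (fun x : X => f (x, y)))
    (f_continuous : forall x : X, continuous (fun y : Y => f (x, y)))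
    (f_discontinuous : forall p : X * Y, ~ {for p, continuous f}) :
  exists Y0 : set Y,
    compact Y0 /\ homeomorphic (set_type Y0) (stone_cech R nat).
Proof.
have [a [b [U0 [V0 [ltab U0_open V0_open cross0]]]]] := crossing_box
  X_nonempty Y_nonempty X_favorable Y_regular Y_separable_compact f_continuous
  f_discontinuous.
have [u uP] := splitting_sequence X_favorable f_quasicontinuous U0_open
  (simultaneous_crossing f_continuous V0_open cross0).
apply: (homeomorphic_dense_compactification (e := @beta_unit R nat) (u := u)).
- exact: beta_compact.
- exact: beta_hausdorff.
- exact: beta_unit_dense.
- exact: beta_unit_separates.
- exact: Y_regular.
- exact: closure_range_compact.
move=> T y Ty nTy; have [x xP] := uP T.
have hi : (b <= f (x, y))%R.
  apply: (@closure_image_subset _ _ u T [set y | (b <= f (x, y))%R]) Ty.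
    by apply: (@closed_comp _ _ (fun y => f (x, y)) [set r | (b <= r)%R]);
      [move=> ? _; exact: f_continuous|exact: closed_ge].
  by move=> n Tn; have := xP n; rewrite mem_set // => /ltW.
have lo : (f (x, y) <= a)%R.
  apply: (@closure_image_subset _ _ u (~` T) [set y | (f (x, y) <= a)%R]) nTy.
    by apply: (@closed_comp _ _ (fun y => f (x, y)) [set r | (r <= a)%R]);
      [move=> ? _; exact: f_continuous|exact: closed_le].
  by move=> n nTn; have := xP n; rewrite memNset // => /ltW.
by have := le_lt_trans (le_trans hi lo) ltab; rewrite ltxx.
Qed.
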